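(* Let $\Omega$ be a semigroup, $(A,(\cdot_{\alpha,\beta})_{\alpha,\beta\in\Omega})$ an $\Omega$-associative algebra and $H'$ a subbialgebra of the cocommutative Hopf algebra $H$. Then $H\otimes H'\otimes A$, where $H$ acts by left multiplication on the first tensor factor, is an $\Omega$-associative $H$-pseudoalgebra with the pseudoproduct $$(f\otimes a\otimes x)*_{\alpha,\beta}(g\otimes b\otimes y)=(f\otimes g a_{(1)})\otimes_H(1\otimes b a_{(2)}\otimes x\cdot_{\alpha,\beta}y),$$ for all $f\otimes a\otimes x,\ g\otimes b\otimes y\in H\otimes H'\otimes A$ and $\alpha,\beta\in\Omega$.
   Context: $k$ is an algebraically closed field of characteristic zero and $H$ is a cocommutative Hopf algebra over $k$ with comultiplication $\Delta(h)=h_{(1)}\otimes h_{(2)}$ (Sweedler notation); $\otimes=\otimes_k$. For $n\ge 1$, $H^{\otimes n}$ is a right $H$-module via the iterated comultiplication, and for a left $H$-module $M$ the space $H^{\otimes n}\otimes_H M$ is a left $H^{\otimes n}$-module by left multiplication. A linear map $*: L\otimes M\to H^{\otimes 2}\otimes_H N$ is $H^{\otimes 2}$-linear if $fa*gb=((f\otimes g)\otimes_H 1)(a*b)$ for all $f,g\in H$. Such maps are composed as follows: if $x*y=\sum_i (f_i\otimes g_i)\otimes_H e_i$ and $F\in H^{\otimes 2}$, then $$(F\otimes_H x)*y=\sum_i (F\otimes 1)(\Delta\otimes \mathrm{id})(f_i\otimes g_i)\otimes_H e_i,\qquad x*(F\otimes_H y)=\sum_i (1\otimes F)(\mathrm{id}\otimes\Delta)(f_i\otimes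 g_i)\otimes_H e_i,$$ elements of $H^{\otimes 3}\otimes_H N$. An $\Omega$-associative algebra is a $k$-vector space $A$ with bilinear maps $\cdot_{\alpha,\beta}:A\times A\to A$ ($\alpha,\beta\in\Omega$) such that $(x\cdot_{\alpha,\beta}y)\cdot_{\alpha\beta,\gamma}z=x\cdot_{\alpha,\beta\gamma}(y\cdot_{\beta,\gamma}z)$ for all $x,y,z\in A$, $\alpha,\beta,\gamma\in\Omega$. An $\Omega$-associative $H$-pseudoalgebra is a left $H$-module $B$ with $H^{\otimes 2}$-linear maps (pseudoproducts) $*_{\alpha,\beta}:B\otimes B\to H^{\otimes 2}\otimes_H B$ ($\alpha,\beta\in\Omega$) such that $(a*_{\alpha,\beta}b)*_{\alpha\beta,\gamma}c=a*_{\alpha,\beta\gamma}(b*_{\beta,\gamma}c)$ for all $a,b,c\in B$, $\alpha,\beta,\gamma\in\Omega$. *)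

(* Defs.v *)
From HB Require Import structures.
From mathcomp Require Import all_boot all_order all_algebra generic_quotient.
From mathcomp Require Import boolp classical_sets.

Set Implicit Arguments.
Unset Strict Implicit.
Unset Printing Implicit Defensive.

Import GRing.Theory.
Local Open Scope quotient_scope.
Local Open Scope ring_scope.

Section LinearExtension.
Context (k : fieldType) (V W : lmodType k).
Implicit Types (G : set (V * W)).
Local Open Scope classical_set_scope.

Definition lgraph G : Prop :=
  [/\ G (0, 0),
      forall (c : k) p q, G p -> G q -> G (c *: p.1 + q.1, c *: p.2 + q.2)
    & forall w, G (0, w) -> w = 0].

Lemma lgraph_fun G : lgraph G -> forall v w w', G (v, w) -> G (v, w') -> w = w'.
Proof.
move=> [_ Gl G0] v w w' Gw Gw'; apply/eqP; rewrite -subr_eq0; apply/eqP/G0.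
by have /= := Gl (-1) _ _ Gw' Gw; rewrite !scaleN1r addNr addrC.
Qed.

Lemma lgraph_extend G : lgraph G ->
  exists f : {linear V -> W}, forall p, G p -> f p.1 = p.2.
Proof.
move=> Ggr; pose P (X : set (V * W)) := lgraph (G `|` X).
have PG : P set0 by rewrite /P setU0.
have /(@Zorn_bigcup _ P)[A [PA Amax]] :
    forall F : set (set (V * W)), F `<=` P -> total_on F subset ->
      P (\bigcup_(X in F) X).
  move=> F FP Ftot; split.
  - by left; case: Ggr.
  - move=> c p q Hp Hq.
    have [F0|[X [FX [GXp GXq]]]] : F = set0 \/
        exists X, F X /\ ((G `|` X) p /\ (G `|` X) q).
    + case: Hp Hq => [Gp|[X FX Xp]] [Gq|[Y FY Yq]].
      * have [->|/set0P[X FX]] := eqVneq F set0; first by left.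
        by right; exists X; split=> //; split; left.
      * by right; exists Y; split=> //; split; [left|right].
      * by right; exists X; split=> //; split; [right|left].
      * right; have [XY|YX] := Ftot _ _ FX FY.
          by exists Y; split=> //; split; right => //; exact: XY.
        by exists X; split=> //; split; right => //; exact: YX.
    + move: Hp Hq; rewrite F0 bigcup_set0 setU0.
      by case: Ggr => _ + _; apply.
    + case: (FP _ FX) => _ /(_ c _ _ GXp GXq) [?|?] _; first by left.
      by right; exists X.
  - move=> w [Gw|[X FX Xw]]; first by case: Ggr => _ _; apply.
    by case: (FP _ FX) => _ _; apply; right.
pose B := G `|` A; have Bgr : lgraph B := PA.
have Btot v : exists w, B (v, w).
  apply: contrapT => vB.
  pose C := [set p : V * W | exists c q, B q /\ p = (c *: v + q.1, q.2)].
  have BC : B `<=` C by move=> q Bq; exists 0, q; rewrite scale0r add0r -surjective_pairing.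
  have [B0 Bl Bf] := Bgr.
  apply: (Amax C); last first.
    rewrite /P (_ : G `|` C = C); last first.
      by rewrite setUidr// => p Gp; apply: BC; left.
    split.
    - exact: BC.
    - move=> c _ _ [a [p [Bp ->]]] [b [q [Bq ->]]] /=.
      exists (c * a + b), (c *: p.1 + q.1, c *: p.2 + q.2); split; first exact: Bl.
      by rewrite /= scalerDr scalerA scalerDl addrACA.
    - move=> w [c [q [Bq]]]; have [->|c0] := eqVneq c 0.
        by rewrite scale0r add0r => -[q0 ->]; apply: Bf; rewrite [X in (X, _)]q0 -surjective_pairing.
      move=> [/eqP]; rewrite eq_sym addr_eq0 => /eqP vq _; exfalso; apply: vB.
      exists ((- c^-1) *: q.2).
      have /= := Bl (- c^-1) _ _ Bq B0; rewrite !addr0.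
      by rewrite scaleNr -scalerN -vq scalerA mulVf// scale1r.
  split; first by move=> p Ap; apply: BC; right.
  move=> CA; apply: vB; exists 0; right; apply: CA; exists 1, (0, 0).
  by split=> //=; rewrite scale1r addr0.
pose f v := projT1 (cid (Btot v)); have fB v : B (v, f v) by exact: projT2 (cid (Btot v)).
have [_ Bl _] := Bgr.
have flin : linear f.
  by move=> c u v; apply: (lgraph_fun Bgr (fB _)); exact: Bl _ _ _ (fB u) (fB v).
pose fL := GRing.isLinear.Build k V W _ f flin.
pose fl : {linear V -> W} := HB.pack f fL.
exists fl.
by move=> [v w] Gp; apply: (lgraph_fun Bgr (fB v)); left.
Qed.

Lemma linear_point (v : V) (w : W) : v != 0 -> exists f : {linear V -> W}, f v = w.
Proof.
move=> v0; pose G := [set p : V * W | exists c : k, p = (c *: v, c *: w)].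
have [|f fG] := @lgraph_extend G; last first.
  by exists f; apply: (fG (v, w)); exists 1; rewrite !scale1r.
split.
- by exists 0; rewrite !scale0r.
- by move=> c _ _ [a ->] [b ->]; exists (c * a + b); rewrite /= !scalerDl !scalerA.
- move=> x [c [/eqP]]; rewrite eq_sym scaler_eq0 (negPf v0) orbF => /eqP -> ->.
  by rewrite scale0r.
Qed.

End LinearExtension.

Section BalancedTensor.
Context {R : Type} {M N : zmodType} (ra : M -> R -> M) (la : R -> N -> N).
Implicit Types s t : seq (M * N).

(* A list [s] stands for the sum of the tensors [p.1 (x) p.2], [p] in [s]. *)
Inductive tens_eq : seq (M * N) -> seq (M * N) -> Prop :=
| TensRefl s : tens_eq s s
| TensSym s t : tens_eq s t -> tens_eq t s
| TensTrans s t u : tens_eq s t -> tens_eq t u -> tens_eq s u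
| TensCat s s' t t' :
    tens_eq s s' -> tens_eq t t' -> tens_eq (s ++ t) (s' ++ t')
| TensComm s t : tens_eq (s ++ t) (t ++ s)
| TensDl m m' n : tens_eq [:: (m + m', n)] [:: (m, n); (m', n)]
| TensDr m n n' : tens_eq [:: (m, n + n')] [:: (m, n); (m, n')]
| Tens0 n : tens_eq [:: (0, n)] [::]
| TensBal m r n : tens_eq [:: (ra m r, n)] [:: (m, la r n)].

Definition tens_eqb : rel (seq (M * N)) := fun s t => `[< tens_eq s t >].

Lemma tens_eqb_refl : reflexive tens_eqb.
Proof. by move=> s; apply/asboolP/TensRefl. Qed.

Lemma tens_eqb_sym : symmetric tens_eqb.
Proof. by move=> s t; apply/asboolP/asboolP; apply: TensSym. Qed.

Lemma tens_eqb_trans : transitive tens_eqb.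
Proof.
by move=> t s u /asboolP st /asboolP tu; apply/asboolP; apply: TensTrans st tu.
Qed.

Canonical tens_equiv :=
  EquivRel tens_eqb tens_eqb_refl tens_eqb_sym tens_eqb_trans.

Definition btensor : Type := {eq_quot tens_equiv}.
HB.instance Definition _ := Choice.on btensor.

Definition tpi (s : seq (M * N)) : btensor := \pi_({eq_quot tens_equiv}) s.
Definition trepr (x : btensor) : seq (M * N) :=
  repr (x : {eq_quot tens_equiv}).

Lemma treprK : cancel trepr tpi.
Proof. exact: reprK. Qed.

Lemma tens_piP s t : tens_eq s t <-> tpi s = tpi t.
Proof.
split=> [st|/eqP]; first by apply/eqP; rewrite /tpi eqmodE; apply/asboolP.
by rewrite /tpi eqmodE => /asboolP.
Qed.

Lemma tens_reprP s : tens_eq (trepr (tpi s)) s.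
Proof. by apply/tens_piP; rewrite treprK. Qed.

Definition btens (m : M) (n : N) : btensor := tpi [:: (m, n)].

Let add (x y : btensor) : btensor := tpi (trepr x ++ trepr y).
Let opp (x : btensor) : btensor :=
  tpi [seq (- p.1, p.2) | p <- trepr x].

Let addE s t : add (tpi s) (tpi t) = tpi (s ++ t).
Proof. by apply/tens_piP/TensCat; apply: tens_reprP. Qed.

Let taddrA : associative add.
Proof.
move=> x y z; rewrite -[x]treprK -[y]treprK -[z]treprK.
by rewrite !addE catA.
Qed.

Let taddrC : commutative add.
Proof. by move=> x y; apply/tens_piP/TensComm. Qed.

Let tadd0r : left_id (tpi [::]) add.
Proof. by move=> x; rewrite -[x]treprK addE. Qed.

Let taddNr : left_inverse (tpi [::]) opp add.
Proof.
move=> x; rewrite -[in X in add _ X](treprK x) addE.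
apply/tens_piP; elim: (trepr x) => [|[m n] s IHs] /=; first exact: TensRefl.
set s' := map _ s in IHs *; rewrite -cat1s -(cat1s (m, n) s).
apply: (@TensTrans _ ([:: (- m, n)] ++ [:: (m, n)] ++ (s' ++ s))).
  apply: (TensCat (TensRefl [:: (- m, n)])).
  rewrite (catA s') (catA _ s'); exact: TensCat (TensComm _ _) (TensRefl _).
apply: (@TensCat [:: (- m, n); (m, n)] [::] _ [::] _ IHs).
apply: TensTrans (TensSym (TensDl _ _ _)) _.
by rewrite addNr; apply: Tens0.
Qed.

HB.instance Definition _ := GRing.isZmodule.Build btensor taddrA taddrC tadd0r taddNr.

Lemma btensDl n : {morph btens^~ n : m m' / m + m'}.
Proof. by move=> m m'; rewrite /= [RHS]addE; apply/tens_piP/TensDl. Qed.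

Lemma btensDr m : {morph btens m : n n' / n + n'}.
Proof. by move=> n n'; rewrite /= [RHS]addE; apply/tens_piP/TensDr. Qed.

Lemma btens_bal m r n : btens (ra m r) n = btens m (la r n).
Proof. exact/tens_piP/TensBal. Qed.

Lemma pi_btensE s : tpi s = \sum_(p <- s) btens p.1 p.2.
Proof.
elim: s => [|[m n] s IHs]; first by rewrite big_nil.
by rewrite big_cons -IHs [RHS]addE.
Qed.

Lemma btensE x : x = \sum_(p <- trepr x) btens p.1 p.2.
Proof. by rewrite -pi_btensE treprK. Qed.

Section Lift.
Context {Z : zmodType}.
Implicit Types f : M -> N -> Z.

Definition balanced f : Prop :=
  [/\ forall n, {morph f^~ n : m m' / m + m'},
      forall m, {morph f m : n n' / n + n'}
    & forall m r n, f (ra m r) n = f m (la r n)].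

(* The map induced by [f] on the tensor product: it sums [f] over a chosen
   expression of [x] as a sum of pure tensors, which is independent of the
   choice as soon as [f] is balanced, see [tliftE] and [tlift_sum]. *)
Definition tlift f (x : btensor) : Z := \sum_(p <- trepr x) f p.1 p.2.

Lemma tlift_pi f : balanced f ->
  forall s, tlift f (tpi s) = \sum_(p <- s) f p.1 p.2.
Proof.
move=> [fDl fDr fbal] s; rewrite /tlift.
move: (trepr _) (tens_reprP s) => t; elim=> {s t} //=.
- by move=> s t u _ -> _ ->.
- by move=> s s' t t' _ IHs _ IHt; rewrite !big_cat IHs IHt.
- by move=> s t; rewrite !big_cat /= addrC.
- by move=> m m' n; rewrite !big_cons !big_nil !addr0 /= fDl.
- by move=> m n n'; rewrite !big_cons !big_nil !addr0 /= fDr.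
- move=> n; rewrite big_cons !big_nil addr0 /=.
  by apply: (addrI (f 0 n)); rewrite -fDl !addr0.
- by move=> m r n; rewrite !big_cons !big_nil /= fbal.
Qed.

Lemma tliftE f : balanced f -> forall m n, tlift f (btens m n) = f m n.
Proof. by move=> fP m n; rewrite tlift_pi// big_seq1. Qed.

Lemma tliftD f : balanced f -> {morph tlift f : x y / x + y}.
Proof.
move=> fP x y; rewrite -[x]treprK -[y]treprK [X in tlift f X]addE.
by rewrite !tlift_pi// big_cat.
Qed.

Lemma tlift_sum f : balanced f -> forall s,
  tlift f (\sum_(p <- s) btens p.1 p.2) = \sum_(p <- s) f p.1 p.2.
Proof. by move=> fP s; rewrite -pi_btensE tlift_pi. Qed.

Lemma btens_ext (g h : btensor -> Z) :
  {morph g : x y / x + y} -> {morph h : x y / x + y} ->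
  (forall m n, g (btens m n) = h (btens m n)) -> g =1 h.
Proof.
move=> gD hD gh x; rewrite (btensE x).
have D0 (l : btensor -> Z) : {morph l : x y / x + y} -> l 0 = 0.
  by move=> lD; apply: (addrI (l 0)); rewrite -lD !addr0.
rewrite (big_morph g gD (D0 _ gD)) (big_morph h hD (D0 _ hD)).
by apply: eq_bigr => p _.
Qed.

End Lift.
End BalancedTensor.

Section Tensor.
Context {k : fieldType} (V W : lmodType k).

Definition tensor : Type :=
  btensor (fun (v : V) (c : k) => c *: v) (fun (c : k) (w : W) => c *: w).
HB.instance Definition _ := GRing.Zmodule.on tensor.

Definition tens (v : V) (w : W) : tensor := btens _ _ v w.

Lemma tensDl w : {morph tens^~ w : v v' / v + v'}.
Proof. exact: btensDl. Qed.

Lemma tensDr v : {morph tens v : w w' / w + w'}.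
Proof. exact: btensDr. Qed.

Lemma tens_bal c v w : tens (c *: v) w = tens v (c *: w).
Proof. exact: btens_bal. Qed.

Let scale (c : k) : tensor -> tensor := tlift (fun v w => tens (c *: v) w).

Let scale_bal c : balanced (fun (v : V) (c : k) => c *: v)
  (fun (c : k) (w : W) => c *: w) (fun v w => tens (c *: v) w).
Proof.
split=> [w v v'|v w w'|v d w]; first by rewrite scalerDr tensDl.
  by rewrite tensDr.
by rewrite scalerA mulrC -scalerA tens_bal.
Qed.

Let scaleE c v w : scale c (tens v w) = tens (c *: v) w.
Proof. exact: tliftE. Qed.

Let scaleD c : {morph scale c : x y / x + y}.
Proof. exact: tliftD. Qed.

Let scaleA a b x : scale a (scale b x) = scale (a * b) x.
Proof.
apply: (@btens_ext _ _ _ _ _ _ (fun x => scale a (scale b x))) x => [x y|x y|v w].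
- by rewrite !scaleD.
- by rewrite scaleD.
- by rewrite !scaleE scalerA.
Qed.

Let scale1 : left_id 1 scale.
Proof.
move=> x; apply: (@btens_ext _ _ _ _ _ _ (scale 1) id) x => [x y|x y|v w] //.
- by rewrite scaleD.
- by rewrite scaleE scale1r.
Qed.

Let scaleDl x : {morph scale^~ x : a b / a + b}.
Proof.
move=> a b.
apply: (@btens_ext _ _ _ _ _ _ (scale (a + b)) (fun x => scale a x + scale b x))
  x => [x y|x y|v w].
- by rewrite scaleD.
- by rewrite !scaleD addrACA.
- by rewrite !scaleE scalerDl tensDl.
Qed.

HB.instance Definition _ :=
  GRing.Zmodule_isLmodule.Build k tensor scaleA scale1 scaleD scaleDl.

Lemma tensZl c v w : tens (c *: v) w = c *: tens v w.
Proof. by rewrite [RHS]scaleE. Qed.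

Lemma tensZr c v w : tens v (c *: w) = c *: tens v w.
Proof. by rewrite -tens_bal tensZl. Qed.

Lemma tensorE (x : tensor) : exists s : seq (V * W), x = \sum_(p <- s) tens p.1 p.2.
Proof. by exists (trepr x); apply: btensE. Qed.

End Tensor.

(* [\ox] has the level and associativity of [*] and [*:], so products inside a
   factor on the right need parentheses. *)
Notation "V ⊗ W" := (tensor V W)
  (at level 40, left associativity, format "V  ⊗  W") : type_scope.
Notation "v \ox w" := (tens v w)
  (at level 40, left associativity, format "v  \ox  w") : ring_scope.

Section TensorMaps.
Context {k : fieldType}.

Definition tmap {V V' W W' : lmodType k} (f : V -> V') (g : W -> W') :
    V ⊗ W -> V' ⊗ W' :=
  tlift (fun v w => f v \ox g w).

Definition tswap {V W : lmodType k} : V ⊗ W -> W ⊗ V :=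
  tlift (fun v w => w \ox v).

Definition tassoc {U V W : lmodType k} : U ⊗ (V ⊗ W) -> (U ⊗ V) ⊗ W :=
  tlift (fun u => tlift (fun v w => (u \ox v) \ox w)).

Lemma bilinear_balanced {V W Z : lmodType k} (f : V -> W -> Z) :
  (forall w, linear (f^~ w)) -> (forall v, linear (f v)) ->
  balanced (fun (v : V) (c : k) => c *: v) (fun (c : k) (w : W) => c *: w) f.
Proof.
move=> fl fr; split=> [w v v'|v w w'|v c w] /=.
- by have /= := fl w 1 v v'; rewrite !scale1r.
- by have := fr v 1 w w'; rewrite !scale1r.
have f0l : f 0 w = 0.
  by have /= := fl w (-1) 0 0; rewrite !scaleN1r oppr0 addr0 addNr.
have f0r : f v 0 = 0 by have := fr v (-1) 0 0; rewrite !scaleN1r oppr0 addr0 addNr.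
by have /= := fl w c v 0; have := fr v c w 0; rewrite f0l f0r !addr0 => -> ->.
Qed.

Lemma tens_ext {V W : lmodType k} {Z : zmodType} (g h : V ⊗ W -> Z) :
  {morph g : x y / x + y} -> {morph h : x y / x + y} ->
  (forall v w, g (v \ox w) = h (v \ox w)) -> g =1 h.
Proof. exact: btens_ext. Qed.

Section TmapTheory.
Context {V V' W W' : lmodType k}.
Context {f : V -> V'} {g : W -> W'} (f_lin : linear f) (g_lin : linear g).

Let tmap_bal : balanced (fun (v : V) (c : k) => c *: v)
  (fun (c : k) (w : W) => c *: w) (fun v w => f v \ox g w).
Proof.
apply: bilinear_balanced => [w c v v'|v c w w'].
- by rewrite f_lin tensDl tensZl.
- by rewrite g_lin tensDr tensZr.
Qed.

Lemma tmapE v w : tmap f g (v \ox w) = f v \ox g w.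
Proof. exact: tliftE. Qed.

Lemma tmapD : {morph tmap f g : x y / x + y}.
Proof. exact: tliftD. Qed.

End TmapTheory.

Section TassocTheory.
Context {U V W : lmodType k}.

Let tassoc_bal2 (u : U) : balanced (fun (v : V) (c : k) => c *: v)
  (fun (c : k) (w : W) => c *: w) (fun v w => (u \ox v) \ox w).
Proof.
apply: bilinear_balanced => [w c v v'|v c w w'].
- by rewrite tensDr tensZr tensDl tensZl.
- by rewrite tensDr tensZr.
Qed.

Let tassoc_bal1 : balanced (fun (u : U) (c : k) => c *: u)
  (fun (c : k) (t : V ⊗ W) => c *: t)
  (fun u => tlift (fun v w => (u \ox v) \ox w)).
Proof.
split=> [t u u'|u|u c]; last 2 first.
- exact: tliftD.
- apply: tens_ext => [x y|x y|v w]; rewrite ?scalerDr ?tliftD//.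
  by rewrite -tensZl [LHS]tliftE// [RHS]tliftE// tens_bal.
- rewrite /tlift -big_split /=; apply: eq_bigr => p _.
  by rewrite !tensDl.
Qed.

Lemma tassocE (u : U) (v : V) (w : W) :
  tassoc (u \ox (v \ox w)) = (u \ox v) \ox w.
Proof. by rewrite [LHS]tliftE// [LHS]tliftE. Qed.

Lemma tassocD : {morph @tassoc U V W : x y / x + y}.
Proof. exact: tliftD. Qed.

End TassocTheory.
End TensorMaps.

Section TensorAlgebra.
Context (k : fieldType) (A B : algType k).
Implicit Types x y z : A ⊗ B.

Let mul x y : A ⊗ B :=
  tlift (fun a b => tlift (fun a' b' => (a * a') \ox (b * b')) y) x.

Let mul_bal2 a b : balanced (fun (v : A) (c : k) => c *: v)
  (fun (c : k) (w : B) => c *: w) (fun a' b' => (a * a') \ox (b * b')).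
Proof.
split=> [b' a' a''|a' b' b''|a' c b'].
- by rewrite mulrDr tensDl.
- by rewrite mulrDr tensDr.
- by rewrite -!scalerAr tens_bal.
Qed.

Let mul_bal1 y : balanced (fun (v : A) (c : k) => c *: v)
  (fun (c : k) (w : B) => c *: w)
  (fun a b => tlift (fun a' b' => (a * a') \ox (b * b')) y : A ⊗ B).
Proof.
split=> [b a a'|a b b'|a c b].
- rewrite /tlift -big_split /=; apply: eq_bigr => p _.
  by rewrite mulrDl tensDl.
- rewrite /tlift -big_split /=; apply: eq_bigr => p _.
  by rewrite mulrDl tensDr.
- rewrite /tlift; apply: eq_bigr => p _.
  by rewrite -!scalerAl tens_bal.
Qed.

Let mulE a b a' b' : mul (a \ox b) (a' \ox b') = (a * a') \ox (b * b').
Proof. by rewrite /mul tliftE// tliftE. Qed.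

Let mulDl : left_distributive mul +%R.
Proof. by move=> x y z; apply: tliftD. Qed.

Let mulDr : right_distributive mul +%R.
Proof.
move=> x y z; rewrite /mul [X in tlift X](_ : _ =
  fun a b => tlift (fun a' b' => (a * a') \ox (b * b')) y +
             tlift (fun a' b' => (a * a') \ox (b * b')) z).
  by rewrite /tlift big_split.
by apply/funext => a; apply/funext => b; rewrite tliftD.
Qed.

Let mulA : associative mul.
Proof.
move=> x y z.
apply: (tens_ext (g := fun x => mul x (mul y z))
                 (h := fun x => mul (mul x y) z)) x => [u v|u v|a b].
- by rewrite mulDl.
- by rewrite !mulDl.
apply: (tens_ext (g := fun y => mul (a \ox b) (mul y z))
                 (h := fun y => mul (mul (a \ox b) y) z)) y => [u v|u v|a' b'].
- by rewrite mulDl mulDr.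
- by rewrite mulDr mulDl.
apply: (tens_ext (g := fun z => mul (a \ox b) (mul (a' \ox b') z))
                 (h := fun z => mul (mul (a \ox b) (a' \ox b')) z)) z
  => [u v|u v|a'' b''].
- by rewrite !mulDr.
- by rewrite mulDr.
- by rewrite !mulE !mulrA.
Qed.

Let tmul1 : left_id (1 \ox 1) mul.
Proof.
move=> x; apply: (tens_ext (g := mul (1 \ox 1)) (h := id)) x => [u v|u v|a b] //.
by rewrite mulE !mul1r.
Qed.

Let tmulr1 : right_id (1 \ox 1) mul.
Proof.
move=> x.
apply: (tens_ext (g := fun x => mul x (1 \ox 1)) (h := id)) x => [u v|u v|a b] //.
by rewrite mulE !mulr1.
Qed.

Let one_neq0 : 1 \ox 1 != 0 :> A ⊗ B.
Proof.
have [f f1] := @linear_point _ A k^o 1 1 (oner_neq0 A).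
have [g g1] := @linear_point _ B k^o 1 1 (oner_neq0 B).
have bal : balanced (fun (v : A) (c : k) => c *: v)
    (fun (c : k) (w : B) => c *: w) (fun a b => f a * g b : k).
  split=> [b a a'|a b b'|a c b].
  - by rewrite linearD mulrDl.
  - by rewrite linearD mulrDr.
  - rewrite !linearZ /=; apply: (etrans (esym (mulrA c (f a) (g b)))).
    exact: mulrCA.
apply/eqP => e; have := tliftE bal 1 1; rewrite [btens _ _ _ _]e f1 g1 mulr1.
have -> : tlift (fun a b => f a * g b) (0 : A ⊗ B) = 0.
  have := tliftD bal 0 0; rewrite addr0 => /esym/eqP.
  by rewrite -subr_eq0 addrK => /eqP.
by move/eqP; rewrite eq_sym oner_eq0.
Qed.

HB.instance Definition _ :=
  GRing.Zmodule_isNzRing.Build (A ⊗ B) mulA tmul1 tmulr1 mulDl mulDr one_neq0.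

Lemma tensM (a a' : A) (b b' : B) :
  (a \ox b) * (a' \ox b') = (a * a') \ox (b * b').
Proof. exact: mulE. Qed.

Let scaleAl (c : k) x y : c *: (x * y) = (c *: x) * y.
Proof.
apply: (tens_ext (g := fun x => c *: (x * y)) (h := fun x => (c *: x) * y)) x
  => [u v|u v|a b].
- by rewrite mulrDl scalerDr.
- by rewrite scalerDr mulrDl.
apply: (tens_ext (g := fun y => c *: ((a \ox b) * y))
                 (h := fun y => (c *: (a \ox b)) * y)) y => [u v|u v|a' b'].
- by rewrite mulrDr scalerDr.
- by rewrite mulrDr.
- by rewrite -tensZl !tensM -tensZl scalerAl.
Qed.

HB.instance Definition _ := GRing.Lmodule_isLalgebra.Build k (A ⊗ B) scaleAl.

Let scaleAr (c : k) x y : c *: (x * y) = x * (c *: y).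
Proof.
apply: (tens_ext (g := fun x => c *: (x * y)) (h := fun x => x * (c *: y))) x
  => [u v|u v|a b].
- by rewrite mulrDl scalerDr.
- by rewrite mulrDl.
apply: (tens_ext (g := fun y => c *: ((a \ox b) * y))
                 (h := fun y => (a \ox b) * (c *: y))) y => [u v|u v|a' b'].
- by rewrite mulrDr scalerDr.
- by rewrite scalerDr mulrDr.
- by rewrite -tensZl !tensM -tensZl scalerAr.
Qed.

HB.instance Definition _ := GRing.Lalgebra_isAlgebra.Build k (A ⊗ B) scaleAr.

End TensorAlgebra.

Section TensorAlgebraMaps.
Context {k : fieldType}.

Lemma tmapM (A A' B B' : algType k) (f : A -> A') (g : B -> B') :
  linear f -> linear g -> {morph f : x y / x * y} -> {morph g : x y / x * y} ->
  {morph tmap f g : x y / x * y}.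
Proof.
move=> fl gl fM gM x y.
have tD := tmapD fl gl.
apply: (tens_ext (g := fun x => tmap f g (x * y))
                 (h := fun x => tmap f g x * tmap f g y)) x => [u v|u v|a b].
- by rewrite mulrDl tD.
- by rewrite tD mulrDl.
apply: (tens_ext (g := fun y => tmap f g ((a \ox b) * y))
                 (h := fun y => tmap f g (a \ox b) * tmap f g y)) y
  => [u v|u v|a' b'].
- by rewrite mulrDr tD.
- by rewrite tD mulrDr.
by rewrite tensM !tmapE// tensM fM gM.
Qed.

Lemma tassocM (A B C : algType k) : {morph @tassoc k A B C : x y / x * y}.
Proof.
have D := @tassocD k A B C.
move=> x y.
apply: (tens_ext (g := fun x => tassoc (x * y))
                 (h := fun x => tassoc x * tassoc y)) x => [u v|u v|a t].
- by rewrite mulrDl D.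
- by rewrite D mulrDl.
apply: (tens_ext (g := fun t => tassoc ((a \ox t) * y))
                 (h := fun t => tassoc (a \ox t) * tassoc y)) t => [u v|u v|b c].
- by rewrite tensDr mulrDl D.
- by rewrite tensDr D mulrDl.
apply: (tens_ext (g := fun y => tassoc ((a \ox (b \ox c)) * y))
                 (h := fun y => tassoc (a \ox (b \ox c)) * tassoc y)) y
  => [u v|u v|a' t'].
- by rewrite mulrDr D.
- by rewrite D mulrDr.
apply: (tens_ext (g := fun t => tassoc ((a \ox (b \ox c)) * (a' \ox t)))
                 (h := fun t => tassoc (a \ox (b \ox c)) * tassoc (a' \ox t))) t'
  => [u v|u v|b' c'].
- by rewrite tensDr mulrDr D.
- by rewrite tensDr D mulrDr.
by rewrite !tensM !tassocE !tensM.
Qed.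

End TensorAlgebraMaps.

Section RestrictScalars.
Context {k : fieldType} {A : algType k}.

(* A left [A]-module seen as a [k]-vector space. *)
Definition kmod (M : lmodType A) : Type := M.

Context (M : lmodType A).
HB.instance Definition _ := GRing.Zmodule.on (kmod M).

Let scale (c : k) (x : M) : M := c%:A *: x.

Let scaleA a b (x : kmod M) : scale a (scale b x) = scale (a * b) x.
Proof. by rewrite /scale scalerA -scalerAl mul1r scalerA. Qed.

Let scale1 : left_id 1 scale.
Proof. by move=> x; rewrite /scale !scale1r. Qed.

Let scaleDr : right_distributive scale +%R.
Proof. by move=> c x y; rewrite /scale scalerDr. Qed.

Let scaleDl x : {morph scale^~ x : a b / a + b}.
Proof. by move=> a b; rewrite /scale !scalerDl. Qed.

HB.instance Definition _ :=
  GRing.Zmodule_isLmodule.Build k (kmod M) scaleA scale1 scaleDr scaleDl.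

End RestrictScalars.

Section InducedModule.
Context {k : fieldType} (A : algType k) (V : lmodType k).

(* [A ⊗ V] with [A] acting by left multiplication on the first factor. It has
   its own name because [A ⊗ V] is already a [k]-module. *)
Definition indmod : Type := A ⊗ V.
HB.instance Definition _ := GRing.Zmodule.on indmod.

Let scale (a : A) : indmod -> indmod := tlift (fun b v => (a * b) \ox v).

Let scale_bal a : balanced (fun (v : A) (c : k) => c *: v)
  (fun (c : k) (w : V) => c *: w) (fun b v => (a * b) \ox v).
Proof.
split=> [w v v'|v w w'|v c w]; first by rewrite mulrDr tensDl.
  by rewrite tensDr.
by rewrite -scalerAr tens_bal.
Qed.

Let scaleE a b v : scale a (b \ox v) = (a * b) \ox v.
Proof. exact: tliftE. Qed.

Let scaleD a : {morph scale a : x y / x + y}.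
Proof. exact: tliftD. Qed.

Let scaleA a b x : scale a (scale b x) = scale (a * b) x.
Proof.
apply: (@btens_ext _ _ _ _ _ _ (fun x => scale a (scale b x))) x => [x y|x y|v w].
- by rewrite !scaleD.
- by rewrite scaleD.
- by rewrite !scaleE mulrA.
Qed.

Let scale1 : left_id 1 scale.
Proof.
move=> x; apply: (@btens_ext _ _ _ _ _ _ (scale 1) id) x => [x y|x y|v w] //.
- by rewrite scaleD.
- by rewrite scaleE mul1r.
Qed.

Let scaleDl x : {morph scale^~ x : a b / a + b}.
Proof.
move=> a b.
apply: (@btens_ext _ _ _ _ _ _ (scale (a + b)) (fun x => scale a x + scale b x))
  x => [x y|x y|v w].
- by rewrite scaleD.
- by rewrite !scaleD addrACA.
- by rewrite !scaleE mulrDl tensDl.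
Qed.

HB.instance Definition _ :=
  GRing.Zmodule_isLmodule.Build A indmod scaleA scale1 scaleD scaleDl.

Lemma indmodZ (a b : A) (v : V) :
  a *: (b \ox v : indmod) = (a * b) \ox v :> indmod.
Proof. exact: scaleE. Qed.

End InducedModule.

Section RelativeTensor.
Context {A P : pzRingType} (d : A -> P) (N : lmodType A).

(* [P ⊗_A N], for [P] the right [A]-module [p . a = p * d a]. *)
Definition rtensor : Type :=
  btensor (fun (p : P) (a : A) => p * d a) (fun (a : A) (x : N) => a *: x).
HB.instance Definition _ := GRing.Zmodule.on rtensor.

Definition rtens (p : P) (x : N) : rtensor := btens _ _ p x.

Let scale (p : P) : rtensor -> rtensor := tlift (fun q x => rtens (p * q) x).

Let scale_bal p : balanced (fun (p : P) (a : A) => p * d a)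
  (fun (a : A) (x : N) => a *: x) (fun q x => rtens (p * q) x).
Proof.
split=> [w v v'|v w w'|v c w]; first by rewrite mulrDr /rtens btensDl.
  by rewrite /rtens btensDr.
by rewrite mulrA [LHS]btens_bal.
Qed.

Let scaleE p q x : scale p (rtens q x) = rtens (p * q) x.
Proof. exact: tliftE. Qed.

Let scaleD a : {morph scale a : x y / x + y}.
Proof. exact: tliftD. Qed.

Let scaleA a b x : scale a (scale b x) = scale (a * b) x.
Proof.
apply: (@btens_ext _ _ _ _ _ _ (fun x => scale a (scale b x))) x => [x y|x y|v w].
- by rewrite !scaleD.
- by rewrite scaleD.
- by rewrite !scaleE mulrA.
Qed.

Let scale1 : left_id 1 scale.
Proof.
move=> x; apply: (@btens_ext _ _ _ _ _ _ (scale 1) id) x => [x y|x y|v w] //.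
- by rewrite scaleD.
- by rewrite scaleE mul1r.
Qed.

Let scaleDl x : {morph scale^~ x : a b / a + b}.
Proof.
move=> a b.
apply: (@btens_ext _ _ _ _ _ _ (scale (a + b)) (fun x => scale a x + scale b x))
  x => [x y|x y|v w].
- by rewrite scaleD.
- by rewrite !scaleD addrACA.
- by rewrite !scaleE mulrDl /rtens btensDl.
Qed.

HB.instance Definition _ :=
  GRing.Zmodule_isLmodule.Build P rtensor scaleA scale1 scaleD scaleDl.

Lemma rtensZ (p q : P) (x : N) : p *: rtens q x = rtens (p * q) x.
Proof. exact: scaleE. Qed.

Lemma rtens_bal (p : P) (a : A) (x : N) : rtens (p * d a) x = rtens p (a *: x).
Proof. exact: btens_bal. Qed.

End RelativeTensor.

Notation "p ⊗_[ d ] x" := (rtens d p x)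
  (at level 40, left associativity, format "p  ⊗_[ d ]  x") : ring_scope.

HB.mixin Record isBialgebra (k : fieldType) H of GRing.Algebra k H := {
  comul : H -> H ⊗ H;
  counit : H -> k;
  comul_is_linear : linear comul;
  comul_is_monoid_morphism : monoid_morphism comul;
  counit_is_scalar : scalar counit;
  counit_is_monoid_morphism : monoid_morphism counit;
  comulA : forall h, tmap comul idfun (comul h) =
                     tassoc (tmap idfun comul (comul h));
  counitl : forall h, tlift (fun a b => counit a *: b) (comul h) = h;
  counitr : forall h, tlift (fun a b => counit b *: a) (comul h) = h }.

#[short(type="bialgType")]
HB.structure Definition Bialgebra (k : fieldType) :=
  { H of isBialgebra k H & GRing.Algebra k H }.

HB.mixin Record isHopf (k : fieldType) H of Bialgebra k H := {
  antipode : H -> H;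
  antipode_is_linear : linear antipode;
  antipodel : forall h : H,
    tlift (fun a b => antipode a * b) (comul h) = (counit h)%:A;
  antipoder : forall h : H,
    tlift (fun a b => a * antipode b) (comul h) = (counit h)%:A }.

#[short(type="hopfType")]
HB.structure Definition Hopf (k : fieldType) :=
  { H of isHopf k H & Bialgebra k H }.

HB.mixin Record isCocommutative (k : fieldType) H of Bialgebra k H := {
  comulC : forall h : H, tswap (comul h) = comul h }.

#[short(type="cocomHopfType")]
HB.structure Definition CocomHopf (k : fieldType) :=
  { H of isCocommutative k H & Hopf k H }.

Section Subbialgebra.
Context {k : fieldType} {H : bialgType k} (S : subalgClosed H).

Definition subalg : Type := {h : H | h \in S}.
HB.instance Definition _ := [isSub of subalg for sval].
HB.instance Definition _ := [Choice of subalg by <:].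
HB.instance Definition _ := [SubChoice_isSubAlgebra of subalg by <:].

(* The comultiplication maps [S] to (the image in [H ⊗ H] of) [S ⊗ S]. *)
Definition subcoalgebra : Prop :=
  forall a : subalg, exists t : subalg ⊗ subalg,
    tmap \val \val t = comul (\val a).

End Subbialgebra.

(* [H^(⊗3)] is represented by [(H ⊗ H) ⊗ H]; [H ⊗ (H ⊗ H)] is identified with
   it by [tassoc]. *)
Definition comul3 {k : fieldType} {H : bialgType k} (h : H) : (H ⊗ H) ⊗ H :=
  tmap comul idfun (comul h).

(* [H^(⊗2) ⊗_H N] and [H^(⊗3) ⊗_H N]. *)
Notation hten2 N := (rtensor comul N).
Notation hten3 N := (rtensor comul3 N).

Section Pseudo.
Context {k : fieldType} {H : bialgType k}.

Lemma idfun_linear : linear (idfun : H -> H).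
Proof. by []. Qed.

Lemma comulM : {morph (@comul k H) : x y / x * y}.
Proof. by case: (@comul_is_monoid_morphism k H). Qed.

Let lC := @comul_is_linear k H.
Let lI := idfun_linear.
Let cD := tmapD lC lI.
Let cM := tmapM lC lI comulM (fun _ _ => erefl).
Let dD := tmapD lI lC.
Let dM := tmapM lI lC (fun _ _ => erefl) comulM.

Section Composition.
Context {L M N : lmodType H}.

Definition expandl (F : H ⊗ H) : hten2 N -> hten3 N :=
  tlift (fun G e => ((F \ox 1) * tmap comul idfun G) ⊗_[comul3] e).

Definition expandr (F : H ⊗ H) : hten2 N -> hten3 N :=
  tlift (fun G e => tassoc ((1 \ox F) * tmap idfun comul G) ⊗_[comul3] e).

Let expandl_bal F : balanced (fun (p : H ⊗ H) (a : H) => p * comul a)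
  (fun (a : H) (x : N) => a *: x)
  (fun G e => ((F \ox 1) * tmap comul idfun G) ⊗_[comul3] e).
Proof.
split=> [e G G'|G e e'|G h e].
- by rewrite cD mulrDr /rtens btensDl.
- by rewrite /rtens btensDr.
- by rewrite cM mulrA [LHS]rtens_bal.
Qed.

Let expandr_bal F : balanced (fun (p : H ⊗ H) (a : H) => p * comul a)
  (fun (a : H) (x : N) => a *: x)
  (fun G e => tassoc ((1 \ox F) * tmap idfun comul G) ⊗_[comul3] e).
Proof.
split=> [e G G'|G e e'|G h e].
- rewrite dD mulrDr -[RHS]btensDl; congr (btens _ _ _ _); exact: tassocD.
- by rewrite /rtens btensDr.
- rewrite dM mulrA -rtens_bal; congr (rtens _ _ _); rewrite /comul3 comulA.
  exact: tassocM.
Qed.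

Lemma expandlE F G e :
  expandl F (G ⊗_[comul] e) = ((F \ox 1) * tmap comul idfun G) ⊗_[comul3] e.
Proof. exact: (tliftE (expandl_bal F)). Qed.

Lemma expandlD F : {morph expandl F : x y / x + y}.
Proof. exact: (tliftD (expandl_bal F)). Qed.

Lemma expandrE F G e :
  expandr F (G ⊗_[comul] e) =
  tassoc ((1 \ox F) * tmap idfun comul G) ⊗_[comul3] e.
Proof. exact: (tliftE (expandr_bal F)). Qed.

Lemma expandrD F : {morph expandr F : x y / x + y}.
Proof. exact: (tliftD (expandr_bal F)). Qed.

(* The composed products [t * y] and [x * t], where [*] is [p]. The sums over
   [tlift] do not depend on the chosen expressions when [p] is pseudolinear,
   see [complE] and [comprE]. *)
Definition compl (p : kmod L ⊗ kmod M -> kmod (hten2 N)) (t : hten2 L) (y : M) : hten3 N :=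
  tlift (fun F x => expandl F (p ((x : kmod L) \ox (y : kmod M)))) t.

Definition compr (p : kmod L ⊗ kmod M -> kmod (hten2 N)) (x : L) (t : hten2 M) : hten3 N :=
  tlift (fun F y => expandr F (p ((x : kmod L) \ox (y : kmod M)))) t.

Definition pseudolinear (p : kmod L ⊗ kmod M -> kmod (hten2 N)) : Prop :=
  forall (f g : H) (a : L) (b : M),
    p ((f *: a : kmod L) \ox (g *: b : kmod M)) =
      (f \ox g) *: (p ((a : kmod L) \ox (b : kmod M)) : hten2 N).

Let expandl_comul F h t :
  expandl (F * comul h) t = expandl F ((h \ox 1) *: t).
Proof.
move: t; apply: btens_ext => [u v|u v|G e].
- exact: expandlD.
- by rewrite scalerDr expandlD.
- rewrite [LHS]expandlE [X in expandl _ X]rtensZ expandlE cM tmapE// mulrA tensM.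
  by rewrite mulr1.
Qed.

Let expandr_comul F h t :
  expandr (F * comul h) t = expandr F ((1 \ox h) *: t).
Proof.
move: t; apply: btens_ext => [u v|u v|G e].
- exact: expandrD.
- by rewrite scalerDr expandrD.
- rewrite [LHS]expandrE [X in expandr _ X]rtensZ expandrE dM tmapE// mulrA tensM.
  by rewrite mulr1.
Qed.

Section WellDefined.
Context (p : {linear kmod L ⊗ kmod M -> kmod (hten2 N)})
        (p_lin : pseudolinear p).

Let compl_bal (y : M) : balanced (fun (q : H ⊗ H) (a : H) => q * comul a)
  (fun (a : H) (x : L) => a *: x)
  (fun F x => expandl F (p ((x : kmod L) \ox (y : kmod M))) : hten3 N).
Proof.
split=> [x F F'|F x x'|F h x].
- move: (p _) => t; rewrite /expandl /tlift -big_split; apply: eq_bigr => q _ /=.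
  by rewrite tensDl mulrDl /rtens btensDl.
- by rewrite tensDl linearD expandlD.
have := p_lin h 1 x y; rewrite scale1r => ->; exact: expandl_comul.
Qed.

Let compr_bal (x : L) : balanced (fun (q : H ⊗ H) (a : H) => q * comul a)
  (fun (a : H) (y : M) => a *: y)
  (fun F y => expandr F (p ((x : kmod L) \ox (y : kmod M))) : hten3 N).
Proof.
split=> [y F F'|F y y'|F h y].
- move: (p _) => t; rewrite /expandr /tlift -big_split; apply: eq_bigr => q _ /=.
  rewrite tensDr mulrDl -[RHS]btensDl; congr (btens _ _ _ _); exact: tassocD.
- by rewrite tensDr linearD expandrD.
have := p_lin 1 h x y; rewrite scale1r => ->; exact: expandr_comul.
Qed.

Lemma complE F (x : L) (y : M) :
  compl p (F ⊗_[comul] x) y = expandl F (p ((x : kmod L) \ox (y : kmod M))).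
Proof. exact: (tliftE (compl_bal y)). Qed.

Lemma complD y : {morph (compl p)^~ y : t u / t + u}.
Proof. exact: (tliftD (compl_bal y)). Qed.

Lemma comprE F (x : L) (y : M) :
  compr p x (F ⊗_[comul] y) = expandr F (p ((x : kmod L) \ox (y : kmod M))).
Proof. exact: (tliftE (compr_bal x)). Qed.

Lemma comprD x : {morph compr p x : t u / t + u}.
Proof. exact: (tliftD (compr_bal x)). Qed.

End WellDefined.
End Composition.

Definition omega_pseudoalgebra (Omega : semigroupType) (B : lmodType H)
    (p : Omega -> Omega -> {linear kmod B ⊗ kmod B -> kmod (hten2 B)}) : Prop :=
  (forall al be, pseudolinear (p al be)) /\
  (forall (al be ga : Omega) (a b c : B),
    compl (p (al * be)%g ga) (p al be ((a : kmod B) \ox (b : kmod B))) c =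
    compr (p al (be * ga)%g) a (p be ga ((b : kmod B) \ox (c : kmod B)))).

End Pseudo.

Definition omega_associative (k : fieldType) (Omega : semigroupType)
    (A : lmodType k) (m : Omega -> Omega -> {bilinear A -> A -> A}) : Prop :=
  forall (al be ga : Omega) (x y z : A),
    m (al * be)%g ga (m al be x y) z = m al (be * ga)%g x (m be ga y z).

(* Main.v *)
(* Take a linear retraction r of the inclusion of S in H. Then (r ⊗ r) o comul
   is a comultiplication [delta] on S, multiplicative and coassociative because
   S ⊗ S and S ⊗ S ⊗ S embed into the tensor powers of H. The pseudoproduct is
   linear in delta(a), hence well defined, and both bracketings of three
   elements are equal to
     (f ⊗ g a1 ⊗ h b1 a2) ⊗_H (1 ⊗ c b2 a3 ⊗ x y z):
   the first through (id ⊗ delta)(delta a), by multiplicativity of delta, the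
   second through (delta ⊗ id)(delta a). *)
From HB Require Import structures.
Require Import Defs.
From mathcomp Require Import all_boot all_order all_algebra.
From mathcomp Require Import boolp.

Set Implicit Arguments.
Unset Strict Implicit.
Unset Printing Implicit Defensive.
Import GRing.Theory.
Local Open Scope ring_scope.

(** * Linearity and extensionality for maps on tensor products *)

Lemma morph_add_sum (V : nmodType) (W : zmodType) (f : V -> W) :
  {morph f : x y / x + y} -> forall (I : Type) (s : seq I) (F : I -> V),
  f (\sum_(i <- s) F i) = \sum_(i <- s) f (F i).
Proof.
move=> fD I s F; apply: (big_morph f fD).
by apply: (addrI (f 0)); rewrite -fD !addr0.
Qed.

Lemma linear_add (R : pzRingType) (V W : lmodType R) (f : V -> W) :
  linear f -> {morph f : x y / x + y}.
Proof. by move=> fl x y; have := fl 1 x y; rewrite !scale1r. Qed.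

Section TensorLinear.
Context {k : fieldType}.
Implicit Types U V W X Z : lmodType k.

Lemma bilin_tliftE V W Z (f : V -> W -> Z) :
  (forall w, linear (f^~ w)) -> (forall v, linear (f v)) ->
  forall v w, tlift f (v \ox w) = f v w.
Proof. by move=> fl fr v w; exact: (tliftE (bilinear_balanced fl fr)). Qed.

Lemma tlift_linear V W Z (f : V -> W -> Z) :
  (forall w, linear (f^~ w)) -> (forall v, linear (f v)) ->
  linear (tlift f : V ⊗ W -> Z).
Proof.
move=> fl fr c x y; have fb := bilinear_balanced fl fr.
rewrite (tliftD fb); congr (_ + _).
apply: (tens_ext (g := fun x => tlift f (c *: x)) (h := fun x => c *: tlift f x)) x
  => [x x'|x x'|v w].
- by rewrite scalerDr (tliftD fb).
- by rewrite (tliftD fb) scalerDr.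
rewrite -tensZl !bilin_tliftE//.
have f0 : f 0 w = 0.
  by have /= := fl w (-1) 0 0; rewrite !scaleN1r oppr0 addr0 addNr.
by have /= := fl w c v 0; rewrite f0 !addr0.
Qed.

(** [tlift] sums over a representative of [x] that does not depend on [u], so linearity in a
    parameter holds summand by summand, without balancedness. *)
Lemma tlift_linear_param U V W Z (F : U -> V -> W -> Z) :
  (forall v w, linear (fun u => F u v w)) ->
  forall x : V ⊗ W, linear (fun u => tlift (F u) x).
Proof.
move=> Fl x c u u'; rewrite /tlift scaler_sumr -big_split /=.
by apply: eq_bigr => p _; rewrite Fl.
Qed.

Lemma tens_linearl V W (w : W) : linear (fun v : V => v \ox w).
Proof. by move=> c v v'; rewrite tensDl tensZl. Qed.

Lemma tens_linearr V W (v : V) : linear (fun w : W => v \ox w).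
Proof. by move=> c w w'; rewrite tensDr tensZr. Qed.

Lemma tmap_linear V V' W W' (f : V -> V') (g : W -> W') :
  linear f -> linear g -> linear (tmap f g).
Proof.
move=> fl gl; apply: tlift_linear => [w|v] c u u'.
  by rewrite fl tensDl tensZl.
by rewrite gl tensDr tensZr.
Qed.

Lemma tmap_comp V V' V'' W W' W'' (f : V -> V') (f' : V' -> V'')
    (g : W -> W') (g' : W' -> W'') :
  linear f -> linear f' -> linear g -> linear g' ->
  forall x, tmap f' g' (tmap f g x) = tmap (f' \o f) (g' \o g) x.
Proof.
move=> fl fl' gl gl'.
have cl (T T' T'' : lmodType k) (h : T -> T') (h' : T' -> T'') :
    linear h -> linear h' -> linear (h' \o h).
  by move=> hl hl' c u u' /=; rewrite hl hl'.
apply: tens_ext => [x y|x y|v w].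
- by rewrite !(tmapD fl gl) !(tmapD fl' gl').
- by rewrite (tmapD (cl _ _ _ _ _ fl fl') (cl _ _ _ _ _ gl gl')).
- by rewrite !tmapE//; apply: cl.
Qed.

(** The hypotheses are pointwise so as to fit the composites produced by [tmap_comp], where [cancel]
    gives only pointwise identities. *)
Lemma tmap_id V W (f : V -> V) (g : W -> W) : f =1 idfun -> g =1 idfun ->
  forall x, tmap f g x = x.
Proof.
move=> /funext -> /funext ->; apply: tens_ext => [x y|//|v w].
- by rewrite tmapD.
- by rewrite tmapE.
Qed.

Lemma tens3_ext U V W (Z : zmodType) (g h : U ⊗ (V ⊗ W) -> Z) :
  {morph g : x y / x + y} -> {morph h : x y / x + y} ->
  (forall u v w, g (u \ox (v \ox w)) = h (u \ox (v \ox w))) -> g =1 h.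
Proof.
move=> gD hD gh; apply: tens_ext => // u t.
apply: (tens_ext (g := fun t => g (u \ox t)) (h := fun t => h (u \ox t))) t
  => [x y|x y|v w] //.
- by rewrite tensDr gD.
- by rewrite tensDr hD.
Qed.

Lemma tmap_assoc U U' V V' W W' (f : U -> U') (g : V -> V') (h : W -> W') :
  linear f -> linear g -> linear h ->
  forall x, tmap (tmap f g) h (tassoc x) = tassoc (tmap f (tmap g h) x).
Proof.
move=> fl gl hl.
have fgl := tmap_linear fl gl; have ghl := tmap_linear gl hl.
have D1 := tmapD fgl hl; have D2 := tmapD fl ghl.
apply: tens3_ext => [x y|x y|u v w].
- rewrite (tassocD x y); exact: D1.
- rewrite (D2 x y); exact: tassocD.
- by rewrite tassocE !tmapE// !tassocE.
Qed.

Lemma linear_retraction V W (f : {linear V -> W}) : injective f ->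
  exists g : {linear W -> V}, cancel f g.
Proof.
move=> finj.
(* This is the graph of [f] transposed: injectivity makes it the graph of a partial linear map on
   [W], which extends to all of [W]. *)
have [|g gf] := @lgraph_extend k W V (fun p => p.1 = f p.2).
  split=> [|c p q /= -> ->|w /=]; rewrite ?raddf0 ?linearP//.
  by rewrite -(raddf0 f) => /finj.
by exists g => v; rewrite (gf (f v, v)).
Qed.

End TensorLinear.

(** * Compatibility of the [k]-structures and of the tensor product over [H] *)

Section ScalarRestriction.
Context {k : fieldType} {H : bialgType k}.

(** Two a priori different [k]-actions meet here: the one restricted from [H], and the one of the
    tensor product. They agree because [c%:A * h = c *: h]. *)
Lemma kmod_indmodZ (V : lmodType k) (c : k) (u : H ⊗ V) :
  c *: (u : kmod (indmod H V)) = (c *: u : H ⊗ V).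
Proof.
pose sc (u : H ⊗ V) : H ⊗ V := c%:A *: (u : indmod H V).
apply: (tens_ext (g := sc) (h := fun u => c *: u)) u => [x y|x y|h v].
- by rewrite /sc [LHS]scalerDr.
- by rewrite scalerDr.
- by rewrite /sc [LHS]indmodZ -scalerAl mul1r tensZl.
Qed.

Lemma comul_scalar (c : k) : comul (c%:A : H) = c%:A.
Proof.
have l := @comul_is_linear k H c 1 0.
have l0 : comul (0 : H) = 0.
  by have /= := @comul_is_linear k H (-1) 0 0; rewrite !scaleN1r oppr0 addr0 addNr.
by move: l; rewrite l0 !addr0 => ->; case: (@comul_is_monoid_morphism k H) => ->.
Qed.

Lemma comul3_scalar (c : k) : comul3 (c%:A : H) = c%:A.
Proof.
rewrite /comul3 comul_scalar -tensZl tmapE ?comul_scalar ?tensZl//.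
exact: comul_is_linear.
Qed.

Section Rtens.
Context {P : algType k} (d : H -> P) (N : lmodType H).
Hypothesis d_scalar : forall c : k, d c%:A = c%:A.

Lemma rtens_linearl (e : N) :
  linear (fun q : P => q ⊗_[d] e : kmod (rtensor d N)).
Proof.
move=> c q q'; rewrite /rtens btensDl; congr (_ + _).
by rewrite [RHS]rtensZ -scalerAl mul1r.
Qed.

(** On [N] the scalar [c] acts as [c%:A] in [H]; it crosses the balanced tensor as [d c%:A], which
    is again a scalar. This is applied to both [comul] and [comul3]. *)
Lemma rtens_linearr (q : P) :
  linear (fun e : kmod N => q ⊗_[d] (e : N) : kmod (rtensor d N)).
Proof.
move=> c e e'; rewrite /rtens btensDr; congr (_ + _).
rewrite -[LHS](rtens_bal _ q (c%:A) e) d_scalar -scalerAr mulr1.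
by rewrite [RHS]rtensZ -scalerAl mul1r.
Qed.

End Rtens.
End ScalarRestriction.

(** * The pseudoproduct built from an algebra map [phi] and a comultiplication [delta] *)

Section CurrentPseudoalgebra.
Context {k : fieldType} {H : bialgType k} {K : algType k} {A : lmodType k}.
Context (phi : {linear K -> H}) (delta : {linear K -> K ⊗ K}).
Hypothesis phiM : {morph phi : x y / x * y}.
Hypothesis deltaM : {morph delta : x y / x * y}.
Hypothesis deltaA : forall a,
  tmap delta idfun (delta a) = tassoc (tmap idfun delta (delta a)).
Hypothesis phi_delta : forall a, tmap phi phi (delta a) = comul (phi a).

Let B := indmod H (K ⊗ A).

(** [K] plays the role of $H'$ and [phi] that of its inclusion in [H]. This is the summand of the
    pseudoproduct for one pair $a_{(1)}\otimes a_{(2)}$, with [z] in place of the product in [A]. *)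
Definition current_term (f g : H) (b a1 a2 : K) (z : A) : kmod (hten2 B) :=
  (f \ox (g * phi a1)) ⊗_[comul] (1 \ox ((b * a2) \ox z) : B).

Let indmod1_linear : linear (fun t : K ⊗ A => (1 \ox t : kmod B)).
Proof.
move=> c t t'; rewrite (tensDr (1 : H)) (tensZr c (1 : H)); congr (_ + _).
by rewrite kmod_indmodZ.
Qed.

Let term_lf g b a1 a2 z : linear (fun f => current_term f g b a1 a2 z).
Proof. by move=> c u u'; rewrite /current_term tens_linearl [LHS]rtens_linearl. Qed.

Let term_lg f b a1 a2 z : linear (fun g => current_term f g b a1 a2 z).
Proof.
by move=> c u u'; rewrite /current_term mulrDl -scalerAl tens_linearr [LHS]rtens_linearl.
Qed.

Let term_la1 f g b a2 z : linear (fun a1 => current_term f g b a1 a2 z).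
Proof.
move=> c u u'; rewrite /current_term linearP mulrDr -scalerAr tens_linearr.
by rewrite [LHS]rtens_linearl.
Qed.

Let term_l2 f g a1 : linear (fun t : K ⊗ A =>
  (f \ox (g * phi a1)) ⊗_[comul] (1 \ox t : B) : kmod (hten2 B)).
Proof. by move=> c u u'; rewrite indmod1_linear [LHS](rtens_linearr comul_scalar). Qed.

Let term_lb f g a1 a2 z : linear (fun b => current_term f g b a1 a2 z).
Proof.
move=> c u u'; rewrite /current_term mulrDl -scalerAl tens_linearl.
exact: term_l2.
Qed.

Let term_la2 f g b a1 z : linear (fun a2 => current_term f g b a1 a2 z).
Proof.
move=> c u u'; rewrite /current_term mulrDr -scalerAr tens_linearl.
exact: term_l2.
Qed.

Let term_lz f g b a1 a2 : linear (fun z => current_term f g b a1 a2 z).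
Proof. move=> c u u'; rewrite /current_term tens_linearr; exact: term_l2. Qed.

(** The argument [d] is to be [delta a]. Leaving it an arbitrary tensor lets later identities be
    checked on pure tensors [a1 \ox a2]. *)
Definition current_kernel (f g : H) (b : K) (z : A) (d : K ⊗ K) : kmod (hten2 B) :=
  tlift (fun a1 a2 => current_term f g b a1 a2 z) d.

Let kernE f g b z a1 a2 : current_kernel f g b z (a1 \ox a2) = current_term f g b a1 a2 z.
Proof.
exact: (bilin_tliftE (fun a2 => @term_la1 f g b a2 z)
                      (fun a1 => @term_la2 f g b a1 z)).
Qed.

Let kern_ld f g b z : linear (current_kernel f g b z).
Proof. by apply: tlift_linear => [a2|a1]; [apply: term_la1|apply: term_la2]. Qed.

Let kern_lf g b z d : linear (fun f => current_kernel f g b z d).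
Proof. by apply: tlift_linear_param => a1 a2; apply: term_lf. Qed.

Let kern_lg f b z d : linear (fun g => current_kernel f g b z d).
Proof. by apply: tlift_linear_param => a1 a2; apply: term_lg. Qed.

Let kern_lb f g z d : linear (fun b => current_kernel f g b z d).
Proof. by apply: tlift_linear_param => a1 a2; apply: term_lb. Qed.

Let kern_lz f g b d : linear (fun z => current_kernel f g b z d).
Proof. by apply: tlift_linear_param => a1 a2; apply: term_lz. Qed.

Section Product.
Context (m : {bilinear A -> A -> A}).

(** The kernel is multilinear in the six components of two pure tensors. It is lifted one tensor
    sign at a time: [b \ox y], [g \ox t], [a \ox x], then [f \ox t]. *)
Let l1 f a x g (t : K ⊗ A) : kmod (hten2 B) :=
  tlift (fun b y => current_kernel f g b (m x y) (delta a)) t.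
Let l2 f a x (v : H ⊗ (K ⊗ A)) : kmod (hten2 B) :=
  tlift (fun g t => l1 f a x g t) v.
Let l3 f (t : K ⊗ A) v : kmod (hten2 B) := tlift (fun a x => l2 f a x v) t.
Let l4 (u v : H ⊗ (K ⊗ A)) : kmod (hten2 B) := tlift (fun f t => l3 f t v) u.

Let ker_mr f g b d x : linear (fun y => current_kernel f g b (m x y) d).
Proof. by move=> c y y'; rewrite linearPr kern_lz. Qed.

Let ker_ml f g b d y : linear (fun x => current_kernel f g b (m x y) d).
Proof. by move=> c x x'; rewrite linearPl kern_lz. Qed.

Let ker_delta f g b z : linear (fun a => current_kernel f g b z (delta a)).
Proof. by move=> c a a'; rewrite linearP kern_ld. Qed.

Let l1_t f a x g : linear (l1 f a x g).
Proof. by apply: tlift_linear => [y|b]; [apply: kern_lb|apply: ker_mr]. Qed.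

Let l1_f a x g t : linear (fun f => l1 f a x g t).
Proof. by apply: tlift_linear_param => b y; apply: kern_lf. Qed.

Let l1_g f a x t : linear (fun g => l1 f a x g t).
Proof. by apply: tlift_linear_param => b y; apply: kern_lg. Qed.

Let l1_a f x g t : linear (fun a => l1 f a x g t).
Proof. by apply: tlift_linear_param => b y; apply: ker_delta. Qed.

Let l1_x f a g t : linear (fun x => l1 f a x g t).
Proof. by apply: tlift_linear_param => b y; apply: ker_ml. Qed.

Let l2_v f a x : linear (l2 f a x).
Proof. by apply: tlift_linear => [t|g]; [apply: l1_g|apply: l1_t]. Qed.

Let l2_f a x v : linear (fun f => l2 f a x v).
Proof. by apply: tlift_linear_param => g t; apply: l1_f. Qed.

Let l2_a f x v : linear (fun a => l2 f a x v).
Proof. by apply: tlift_linear_param => g t; apply: l1_a. Qed.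

Let l2_x f a v : linear (fun x => l2 f a x v).
Proof. by apply: tlift_linear_param => g t; apply: l1_x. Qed.

Let l3_t f v : linear (fun t => l3 f t v).
Proof. by apply: tlift_linear => [x|a]; [apply: l2_a|apply: l2_x]. Qed.

Let l3_f t v : linear (fun f => l3 f t v).
Proof. by apply: tlift_linear_param => a x; apply: l2_f. Qed.

Let l3_v f t : linear (l3 f t).
Proof. by apply: tlift_linear_param => a x; apply: l2_v. Qed.

Let l4_u v : linear (fun u => l4 u v).
Proof. by apply: tlift_linear => [t|f]; [apply: l3_f|apply: l3_t]. Qed.

Let l4_v u : linear (l4 u).
Proof. by apply: tlift_linear_param => f t; apply: l3_v. Qed.

Let l4E f a x g b y : l4 (f \ox (a \ox x)) (g \ox (b \ox y)) =
  current_kernel f g b (m x y) (delta a).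
Proof.
rewrite /l4 (bilin_tliftE (fun t => l3_f t _) (fun f => l3_t f _)).
rewrite /l3 (bilin_tliftE (fun x => l2_a _ x _) (fun a => l2_x _ a _)).
rewrite /l2 (bilin_tliftE (fun t => l1_g _ _ _ t) (fun g => l1_t _ _ _ g)).
by rewrite /l1 (bilin_tliftE (fun y => @kern_lb _ _ _ _) (fun b => @ker_mr _ _ _ _ _)).
Qed.

Let l4_ku (v : kmod B) : linear (fun u : kmod B => l4 u v).
Proof. by move=> c u u'; rewrite kmod_indmodZ; apply: l4_u. Qed.

Let l4_kv (u : kmod B) : linear (fun v : kmod B => l4 u v).
Proof. by move=> c v v'; rewrite kmod_indmodZ; apply: l4_v. Qed.

Let prod_fun : kmod B ⊗ kmod B -> kmod (hten2 B) :=
  tlift (l4 : kmod B -> kmod B -> kmod (hten2 B)).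

Let prod_linear : linear prod_fun.
Proof. by apply: tlift_linear => [v|u]; [apply: l4_ku|apply: l4_kv]. Qed.

Definition current_product : {linear kmod B ⊗ kmod B -> kmod (hten2 B)} :=
  HB.pack prod_fun (GRing.isLinear.Build k _ _ _ prod_fun prod_linear).

Lemma current_product_kernel f a x g b y :
  current_product ((f \ox (a \ox x) : kmod B) \ox (g \ox (b \ox y) : kmod B)) =
  current_kernel f g b (m x y) (delta a).
Proof. by rewrite -l4E; exact: (bilin_tliftE l4_ku l4_kv). Qed.

Lemma current_productE f a x g b y (s : seq (K * K)) :
  delta a = \sum_(q <- s) q.1 \ox q.2 ->
  (current_product ((f \ox (a \ox x) : kmod B) \ox (g \ox (b \ox y) : kmod B))
    : hten2 B) =
  \sum_(q <- s) (f \ox (g * phi q.1)) ⊗_[comul]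
                (1 \ox ((b * q.2) \ox m x y) : B).
Proof.
move=> as_; rewrite current_product_kernel as_.
exact: (tlift_sum (bilinear_balanced (fun a2 => @term_la1 f g b a2 (m x y))
  (fun a1 => @term_la2 f g b a1 (m x y))) s).
Qed.

End Product.

(** [H ⊗ H] acts by left multiplication, and [f], [g] stand leftmost in the two factors of each
    term. *)
Let kernM f f' g g' b z d :
  current_kernel (f * f') (g * g') b z d =
  (f \ox g) *: (current_kernel f' g' b z d : hten2 B).
Proof.
apply: (tens_ext (g := current_kernel (f * f') (g * g') b z)
  (h := fun d => (f \ox g) *: (current_kernel f' g' b z d : hten2 B))) d
  => [x y|x y|a1 a2].
- exact: (linear_add (kern_ld _ _ _ _)).
- by rewrite (linear_add (kern_ld _ _ _ _)) [LHS]scalerDr.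
- by rewrite !kernE [RHS]rtensZ tensM mulrA.
Qed.

Lemma current_product_pseudolinear m : pseudolinear (current_product m).
Proof.
move=> f g a b.
apply: (tens3_ext
  (g := fun a => current_product m (((f *: (a : B)) : kmod B) \ox (g *: b : kmod B)))
  (h := fun a => (f \ox g) *:
    (current_product m ((a : kmod B) \ox (b : kmod B)) : hten2 B))) a
  => [u u'|u u'|f' a x].
- by rewrite [X in X \ox _]scalerDr tensDl linearD.
- by rewrite tensDl linearD [LHS]scalerDr.
apply: (tens3_ext
  (g := fun b => current_product m
    (((f *: ((f' \ox (a \ox x)) : B)) : kmod B) \ox (g *: (b : B) : kmod B)))
  (h := fun b => (f \ox g) *: (current_product m
    (((f' \ox (a \ox x)) : kmod B) \ox (b : kmod B)) : hten2 B))) b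
  => [u u'|u u'|g' b y].
- by rewrite [X in _ \ox X]scalerDr tensDr linearD.
- by rewrite tensDr linearD [LHS]scalerDr.
by rewrite !indmodZ !current_product_kernel kernM.
Qed.

(** * Associativity: both bracketings reduced to one trilinear expression *)

Section Assoc.
Context (f g h : H) (c r1 r2 : K) (v : A).

(** The common form of a term of both bracketings: [r1], [r2] stand for $b_{(1)}$, $b_{(2)}$, and
    [v] for the triple product in [A]. *)
Let term3 (a1 a2 a3 : K) : kmod (hten3 B) :=
  ((f \ox (g * phi a1)) \ox (h * phi r1 * phi a2)) ⊗_[comul3]
  (1 \ox ((c * r2 * a3) \ox v) : B).

Let term3_l1 a2 a3 : linear (fun a1 => term3 a1 a2 a3).
Proof.
move=> e u u'; rewrite /term3 linearP mulrDr -scalerAr tens_linearr tens_linearl.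
by rewrite [LHS]rtens_linearl.
Qed.

Let term3_l2 a1 a3 : linear (fun a2 => term3 a1 a2 a3).
Proof.
move=> e u u'; rewrite /term3 linearP mulrDr -scalerAr tens_linearr.
by rewrite [LHS]rtens_linearl.
Qed.

Let term3_l3 a1 a2 : linear (fun a3 => term3 a1 a2 a3).
Proof.
move=> e u u'; rewrite /term3 mulrDr -scalerAr tens_linearl indmod1_linear.
by rewrite [LHS](rtens_linearr comul3_scalar).
Qed.

Definition pair_kernel (t : K ⊗ K) a3 := tlift (fun a1 a2 => term3 a1 a2 a3) t.
Definition triple_kernel (t : K ⊗ K ⊗ K) : kmod (hten3 B) := tlift pair_kernel t.

Let pair_l1 a3 : linear (pair_kernel^~ a3).
Proof. by apply: tlift_linear => [a2|a1]; [apply: term3_l1|apply: term3_l2]. Qed.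

Let pair_l2 t : linear (pair_kernel t).
Proof. by apply: tlift_linear_param => a1 a2; apply: term3_l3. Qed.

Lemma triple_kernelD : {morph triple_kernel : x y / x + y}.
Proof. by apply: linear_add; apply: tlift_linear. Qed.

Let triple_kernelE a1 a2 a3 : triple_kernel (a1 \ox a2 \ox a3) = term3 a1 a2 a3.
Proof.
rewrite /triple_kernel (bilin_tliftE pair_l1 pair_l2) /pair_kernel.
exact: (bilin_tliftE (fun a2 => @term3_l1 a2 a3) (fun a1 => @term3_l2 a1 a3)).
Qed.

(** One term of the left bracketing. The inner product yields $1\otimes ba_{(2)}\otimes xy$, hence
    the argument [1]; the tensor [r1 \ox r2 * t] is a term of [delta b * delta a2]. *)
Lemma expandl_current_kernel a1 t :
  expandl (f \ox (g * phi a1)) (current_kernel 1 h c v (r1 \ox r2 * t)) =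
  triple_kernel (tassoc (a1 \ox t)).
Proof.
apply: (tens_ext
  (g := fun t => expandl (f \ox (g * phi a1))
    (current_kernel 1 h c v (r1 \ox r2 * t)))
  (h := fun t => triple_kernel (tassoc (a1 \ox t)))) t => [x y|x y|a2 a3].
- by rewrite mulrDr (linear_add (kern_ld _ _ _ _)) expandlD.
- rewrite tensDr (tassocD (a1 \ox x) (a1 \ox y)); exact: triple_kernelD.
rewrite tassocE triple_kernelE tensM kernE [LHS]expandlE tmapE//;
  last exact: comul_is_linear.
(* Since $\Delta(1)=1$, the factor [f \ox (g * phi a1)] is left unchanged. *)
case: (@comul_is_monoid_morphism k H) => -> _.
by rewrite tensM mulr1 mul1r !mulrA /term3 phiM mulrA.
Qed.

(** One term of the right bracketing, with [d] for [delta a]. Here $\mathrm{id}\otimes\Delta$ acts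
    on [f \ox phi a1], so it is the first leg of [d] that is split further. *)
Lemma expandr_current_kernel d :
  expandr (g \ox (h * phi r1)) (current_kernel f 1 (c * r2) v d) =
  triple_kernel (tmap delta idfun d).
Proof.
have il : linear (idfun : K -> K) by [].
have dD := tmapD (linearP delta) il.
apply: (tens_ext
  (g := fun d => expandr (g \ox (h * phi r1)) (current_kernel f 1 (c * r2) v d))
  (h := fun d => triple_kernel (tmap delta idfun d))) d => [x y|x y|a1 a3].
- by rewrite (linear_add (kern_ld _ _ _ _)) expandrD.
- by rewrite dD triple_kernelD.
rewrite kernE [LHS]expandrE mul1r !tmapE//; last 2 first.
- exact: comul_is_linear.
- exact: linearP.
(* $\Delta$ of [phi a1] becomes the image of [delta a1], which is then replaced by an arbitrary
   tensor [t]. *)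
rewrite -phi_delta tensM mul1r.
have pD := tmapD (linearP phi) (linearP phi).
apply: (tens_ext
  (g := fun t => tassoc (f \ox (g \ox (h * phi r1) * tmap phi phi t))
    ⊗_[comul3] ((1 \ox (c * r2 * a3 \ox v)) : B))
  (h := fun t => triple_kernel (t \ox a3))) (delta a1) => [x y|x y|a1' a2].
- by rewrite pD mulrDr tensDr tassocD /rtens btensDl.
- by rewrite tensDl triple_kernelD.
rewrite triple_kernelE tmapE; [|exact: linearP|exact: linearP].
by rewrite tensM tassocE.
Qed.

End Assoc.

Lemma compl_current_kernel (m : {bilinear A -> A -> A}) f g h b c w z d
    (s : seq (K * K)) :
  delta b = \sum_(r <- s) r.1 \ox r.2 ->
  compl (current_product m) (current_kernel f g b w d) (h \ox (c \ox z) : B) =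
  \sum_(r <- s) triple_kernel f g h c r.1 r.2 (m w z) (tassoc (tmap idfun delta d)).
Proof.
move=> bs; have il : linear (idfun : K -> K) by [].
have iD := tmapD il (linearP delta).
have cD := complD (@current_product_pseudolinear m).
apply: (tens_ext
  (g := fun d => compl (current_product m) (current_kernel f g b w d)
    (h \ox (c \ox z) : B))
  (h := fun d => \sum_(r <- s)
    triple_kernel f g h c r.1 r.2 (m w z) (tassoc (tmap idfun delta d)))) d
  => [x y|x y|a1 a2].
- by rewrite (linear_add (kern_ld _ _ _ _)) cD.
- rewrite -big_split; apply: eq_bigr => r _ /=.
  rewrite iD (tassocD (tmap idfun delta x) (tmap idfun delta y)); exact: triple_kernelD.
rewrite kernE [LHS](complE (@current_product_pseudolinear m)) current_product_kernel.
rewrite tmapE//; last exact: linearP.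
(* The outer product comultiplies [b * a2]; multiplicativity of [delta] separates the terms [r] of
   [delta b] from [delta a2]. *)
rewrite deltaM bs mulr_suml (morph_add_sum (linear_add (kern_ld _ _ _ _))).
rewrite (morph_add_sum (@expandlD _ _ _ _)); apply: eq_bigr => r _.
exact: expandl_current_kernel.
Qed.

Lemma compr_current_kernel (m : {bilinear A -> A -> A}) f a x g h c w
    (s : seq (K * K)) :
  compr (current_product m) (f \ox (a \ox x) : B)
    (current_kernel g h c w (\sum_(r <- s) r.1 \ox r.2)) =
  \sum_(r <- s) triple_kernel f g h c r.1 r.2 (m x w) (tmap delta idfun (delta a)).
Proof.
have cD := comprD (@current_product_pseudolinear m).
rewrite (morph_add_sum (linear_add (kern_ld _ _ _ _))) (morph_add_sum (cD _)).
apply: eq_bigr => r _; rewrite kernE [LHS](comprE (@current_product_pseudolinear m)).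
by rewrite current_product_kernel expandr_current_kernel.
Qed.

(** With four unrelated products, the indices in [Omega] enter only through the one identity assumed
    on [A]. *)
Lemma current_product_assoc (m1 m2 m3 m4 : {bilinear A -> A -> A}) :
  (forall x y z, m2 (m1 x y) z = m4 x (m3 y z)) ->
  forall a b c : B,
  compl (current_product m2) (current_product m1 ((a : kmod B) \ox (b : kmod B))) c =
  compr (current_product m4) a (current_product m3 ((b : kmod B) \ox (c : kmod B))).
Proof.
move=> mA a b c.
have lD := complD (@current_product_pseudolinear m2).
have rD := comprD (@current_product_pseudolinear m4).
(* In the argument lying in [B] itself, additivity holds term by term over the chosen representative
   of [t]. *)
have lDr t : {morph compl (current_product m2) t : u v / u + v}.
  move=> u v; rewrite /compl /tlift -big_split; apply: eq_bigr => q _.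
  by rewrite tensDr linearD expandlD.
have rDl t : {morph (compr (current_product m4))^~ t : u v / u + v}.
  move=> u v; rewrite /compr /tlift -big_split; apply: eq_bigr => q _.
  by rewrite tensDl linearD expandrD.
apply: (tens3_ext
  (g := fun a => compl (current_product m2)
    (current_product m1 ((a : kmod B) \ox (b : kmod B))) c)
  (h := fun a => compr (current_product m4) a
    (current_product m3 ((b : kmod B) \ox (c : kmod B))))) a => [u v|u v|f a x].
- by rewrite tensDl linearD lD.
- exact: rDl.
apply: (tens3_ext
  (g := fun b => compl (current_product m2)
    (current_product m1 ((f \ox (a \ox x) : kmod B) \ox (b : kmod B))) c)
  (h := fun b => compr (current_product m4) (f \ox (a \ox x))
    (current_product m3 ((b : kmod B) \ox (c : kmod B))))) b => [u v|u v|g b y].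
- by rewrite tensDr linearD lD.
- by rewrite tensDl linearD rD.
apply: (tens3_ext
  (g := fun c => compl (current_product m2)
    (current_product m1 ((f \ox (a \ox x) : kmod B) \ox (g \ox (b \ox y) : kmod B))) c)
  (h := fun c => compr (current_product m4) (f \ox (a \ox x))
    (current_product m3 ((g \ox (b \ox y) : kmod B) \ox (c : kmod B))))) c
  => [u v|u v|h c z].
- exact: lDr.
- by rewrite tensDr linearD rD.
(* One decomposition of [delta b] indexes the sums on both sides; their terms then agree by [mA] and
   coassociativity of [delta] at [a]. *)
have [s bs] := tensorE (delta b).
rewrite !current_product_kernel (compl_current_kernel _ _ _ _ _ _ _ _ bs) bs.
by rewrite compr_current_kernel mA deltaA.
Qed.

Lemma current_omega_pseudoalgebra (Omega : semigroupType)
    (m : Omega -> Omega -> {bilinear A -> A -> A}) : injective (tmap phi phi) ->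
  omega_associative m ->
  exists p : Omega -> Omega -> {linear kmod B ⊗ kmod B -> kmod (hten2 B)},
    omega_pseudoalgebra p /\
    forall (al be : Omega) (f g : H) (a b : K) (x y : A) (s : seq (K * K)),
      comul (phi a) = \sum_(q <- s) phi q.1 \ox phi q.2 ->
      (p al be ((f \ox (a \ox x) : kmod B) \ox (g \ox (b \ox y) : kmod B))
         : hten2 B) =
      \sum_(q <- s) (f \ox (g * phi q.1)) ⊗_[comul]
                    (1 \ox ((b * q.2) \ox m al be x y) : B).
Proof.
move=> phi2I mA; exists (fun al be => current_product (m al be)).
split=> [|al be f g a b x y s as_].
  split=> [al be|al be ga]; first exact: current_product_pseudolinear.
  by apply: current_product_assoc => x y z; apply: mA.
(* The list [s] decomposes $\Delta(a)$ in [H ⊗ H]; injectivity of [tmap phi phi] brings this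
   decomposition back to [delta a] in [K ⊗ K]. *)
apply: current_productE; apply: phi2I; rewrite phi_delta as_.
rewrite (morph_add_sum (tmapD (linearP phi) (linearP phi))).
by apply: eq_bigr => q _; rewrite [RHS](tmapE (linearP phi) (linearP phi)).
Qed.

End CurrentPseudoalgebra.

(** * The comultiplication of a subbialgebra, and the conclusion *)

Lemma tmap_cancel (k : fieldType) (V V' W W' : lmodType k) (f : V -> V')
    (f' : V' -> V) (g : W -> W') (g' : W' -> W) :
  linear f -> linear f' -> linear g -> linear g' ->
  cancel f f' -> cancel g g' -> cancel (tmap f g) (tmap f' g').
Proof. by move=> fl fl' gl gl' ff' gg' x; rewrite tmap_comp// tmap_id. Qed.

(** [subcoalgebra] only provides a preimage of $\Delta(a)$ for each [a]; going through a retraction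
    makes the choice visibly linear. *)
Lemma subcoalgebra_comul (k : fieldType) (H : bialgType k) (S : subalgClosed H) :
  subcoalgebra S ->
  exists delta : {linear subalg S -> subalg S ⊗ subalg S},
    [/\ {morph delta : x y / x * y},
        forall a, tmap delta idfun (delta a) = tassoc (tmap idfun delta (delta a)),
        forall a, tmap \val \val (delta a) = comul (\val a)
      & injective (tmap \val \val : subalg S ⊗ subalg S -> H ⊗ H)].
Proof.
move=> S_subcoalg; pose phi : {linear subalg S -> H} := \val.
have [r phiK] : exists r : {linear H -> subalg S}, cancel phi r.
  exact: (linear_retraction (f := phi) val_inj).
have pl : linear phi by exact: linearP.
have rl : linear r by exact: linearP.
have ppl := tmap_linear pl pl; have rrl := tmap_linear rl rl.
have phi2K := tmap_cancel pl rl pl rl phiK phiK.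
have phi3K := tmap_cancel ppl rrl pl rl phi2K phiK.
have cl := @comul_is_linear k H.
pose d a := tmap r r (comul (phi a)).
have dl : linear d by move=> c a a'; rewrite /d linearP cl rrl.
have phid a : tmap phi phi (d a) = comul (phi a).
  (* $\Delta(a)$ is the image of some [t], and [tmap r r] undoes [tmap phi phi], so [d a] is [t]. *)
  by have [t et] := S_subcoalg a; rewrite /d -[comul _]et phi2K.
have pM : {morph phi : x y / x * y} by exact: rmorphM.
pose delta : {linear subalg S -> subalg S ⊗ subalg S} :=
  HB.pack d (GRing.isLinear.Build k _ _ _ d dl).
exists delta.
split=> [x y|a||] /=; first 1 last.
(* Both sides are compared inside $H^{\otimes 3}$. Moving [phi] past [d] by [e1] turns the equation
   into [comulA] at [phi a]. *)
- apply: (can_inj phi3K); have il (V : lmodType k) : linear (idfun : V -> V) by [].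
  rewrite tmap_comp// tmap_assoc//.
  rewrite (tmap_comp (il _) pl dl ppl).
  have e1 : tmap phi phi \o d = comul \o phi by apply/funext.
  rewrite e1 -(tmap_comp pl cl pl (il _)) -(tmap_comp pl (il _) pl cl) !phid.
  exact: comulA.
- exact: phid.
- exact: (can_inj phi2K).
- apply: (can_inj phi2K); rewrite (tmapM pl pl pM pM) !phid pM.
  exact: comulM.
Qed.

(** Sweedler notation becomes a list [s] of pairs from [S] that represents $\Delta(a)$. Such lists
    exist by [S_subcoalg], and the formula holds for each of them. *)
Lemma current_pseudoalgebra (k : fieldType) (H : bialgType k)
    (S : subalgClosed H) (S_subcoalg : subcoalgebra S)
    (Omega : semigroupType) (A : lmodType k)
    (m : Omega -> Omega -> {bilinear A -> A -> A})
    (m_assoc : omega_associative m) :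
  let B := indmod H (subalg S ⊗ A) in
  exists p : Omega -> Omega -> {linear kmod B ⊗ kmod B -> kmod (hten2 B)},
    omega_pseudoalgebra p /\
    forall (al be : Omega) (f g : H) (a b : subalg S) (x y : A)
        (s : seq (subalg S * subalg S)),
      comul (\val a) = \sum_(q <- s) \val q.1 \ox \val q.2 ->
      (p al be ((f \ox (a \ox x) : kmod B) \ox (g \ox (b \ox y) : kmod B))
         : hten2 B) =
      \sum_(q <- s) (f \ox (g * \val q.1)) ⊗_[comul]
                    (1 \ox ((b * q.2) \ox m al be x y) : B).
Proof.
have [d [dM dA phid val2I]] := subcoalgebra_comul S_subcoalg.
(* The [k]-module [subalg S] is only convertible to the one underlying the
   algebra [K]: unifying them inside [exists] does not terminate in practice,
   whereas converting the closed type of [res] does. *)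
pose K : algType k := subalg S.
pose phi : {linear K -> H} := \val.
pose delta : {linear K -> K ⊗ K} := d.
have phiM : {morph phi : x y / x * y} by exact: rmorphM.
have dM' : {morph delta : x y / x * y} by exact: dM.
have phid' a : tmap phi phi (delta a) = comul (phi a) by exact: phid.
have phi2I : injective (tmap phi phi) by exact: val2I.
have res := @current_omega_pseudoalgebra k H K A phi delta phiM dM' dA phid'
  Omega m phi2I m_assoc.
exact res.
Qed.

Theorem proposition3p5 (k : closedFieldType) (k_char0 : [pchar k] =i pred0)
    (H : cocomHopfType k) (S : subalgClosed H) (S_subcoalg : subcoalgebra S)
    (Omega : semigroupType) (A : lmodType k)
    (m : Omega -> Omega -> {bilinear A -> A -> A})
    (m_assoc : omega_associative m) :
  let B := indmod H (subalg S ⊗ A) in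
  exists p : Omega -> Omega -> {linear kmod B ⊗ kmod B -> kmod (hten2 B)},
    omega_pseudoalgebra p /\
    forall (al be : Omega) (f g : H) (a b : subalg S) (x y : A)
        (s : seq (subalg S * subalg S)),
      comul (\val a) = \sum_(q <- s) \val q.1 \ox \val q.2 ->
      (p al be ((f \ox (a \ox x) : kmod B) \ox (g \ox (b \ox y) : kmod B))
         : hten2 B) =
      \sum_(q <- s) (f \ox (g * \val q.1)) ⊗_[comul]
                    (1 \ox ((b * q.2) \ox m al be x y) : B).
Proof. exact: (current_pseudoalgebra S_subcoalg m_assoc). Qed.
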